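(* There exists a (randomized) streaming algorithm that, given an integer $k\ge 1$ and $n$ coins arriving one by one in a stream in arbitrary order, with gap parameter $\Delta_k>0$ (the gap between the biases of the $k$-th and $(k+1)$-th most biased coins) and confidence parameter $\delta\in(0,1/2)$, finds the $k$ most biased coins with probability at least $1-\delta$ using $O\!\left(\frac{n}{\Delta_k^2}\cdot\log(k/\delta)\right)$ coin tosses and a memory of $O(k)$ coins.
   Context: Streaming top-$k$ coin tossing. There are $n$ coins with unknown biases $p_1,\dots,p_n\in[0,1]$; each toss of the $i$-th coin is an independent Bernoulli$(p_i)$ random variable. Let $\mathrm{coin}_{[i]}$ denote the $i$-th most biased coin and $p_{[i]}$ its bias. The gap parameter is $\Delta_k=p_{[k]}-p_{[k+1]}$, assumed positive (so the set of the $k$ most biased coins is unique). The values $k,\Delta_k,\delta$ are known to the algorithm. The coins arrive one by one in a stream. At any time the algorithm may toss only the currently arriving coin or a coin explicitly stored in its memory; a coin that is not stored, or that is removed from memory, can no longer be tossed or recovered. The memory of the algorithm is the maximum number of coins it stores at any point (auxiliary information such as counters is not counted). ''Finds the $k$ most biased coins'' means that at the end of the stream the algorithm outputs exactly the set $\{\mathrm{coin}_{[1]},\dots,\mathrm{coin}_{[k]}\}$ (in no particular order). $O(\cdot)$ hides absolute constants. *)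

(* Defs.v *)
From mathcomp Require Import all_boot all_order all_algebra.
From mathcomp Require Import all_classical all_reals all_analysis.

Set Implicit Arguments.
Unset Strict Implicit.
Unset Printing Implicit Defensive.

Import Order.TTheory GRing.Theory Num.Theory.
Local Open Scope ring_scope.

(* A stream of n coins is the sequence p of their biases in arrival order.
   Throughout, a coin is named by its 0-based arrival position, so that p`_i
   is the bias of coin i. *)
Section Ranking.
Context {R : realType}.
Implicit Type p : seq R.

Definition ranking p : seq nat :=
  sort (fun i j => p`_j <= p`_i) (iota 0 (size p)).

(* coin_[i] and p_[i], with i counted from 1 *)
Definition ranked_coin p (i : nat) : nat := nth 0%N (ranking p) i.-1.
Definition ranked_bias p (i : nat) : R := p`_(ranked_coin p i).

Definition top_coins (k : nat) p : seq nat :=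
  [seq ranked_coin p i | i <- iota 1 k].

Definition gap (k : nat) p : R := ranked_bias p k - ranked_bias p k.+1.

End Ranking.

(* What an algorithm does between two consecutive arrivals (or after the end of
   the stream), as a decision tree. [Toss i f] continues with [f b], where b is
   the outcome of the toss (true = heads); [Uniform m f] draws internal
   randomness, uniform on m.+1 values. *)
Inductive prog (A : Type) : Type :=
| Ret of A
| Toss of nat & (bool -> prog A)
| StoreCurrent of prog A
| Discard of nat & prog A
| Uniform (m : nat) of ('I_m.+1 -> prog A).

(* [state] is the auxiliary information, which is not charged for. Coins are
   not part of it: a state may contain names of coins, but tossing or returning
   a coin is subject to the legality conditions of [ledger] below. The program
   [arrival s] is run upon each arrival and [finish s] once the stream has
   ended, so that the length of the stream is not known beforehand. *)
Record streaming_algorithm : Type := StreamingAlgorithm {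
  state : Type;
  start : state;
  arrival : state -> prog state;
  finish : state -> prog (seq nat)
}.

(* Resource accounting along one execution: the coins in memory, the number of
   tosses made so far, the largest number of coins stored so far, and whether
   every action so far was permitted. *)
Record ledger : Type := Ledger {
  stored : seq nat;
  tosses : nat;
  peak : nat;
  legal : bool
}.

Definition ledger0 : ledger := Ledger [::] 0 0 true.

(* In the following operations, [cur] is the currently arriving coin, and is
   None after the end of the stream. *)
Definition accessible (cur : option nat) (l : ledger) (i : nat) : bool :=
  (cur == Some i) || (i \in stored l).

Definition log_toss (cur : option nat) (i : nat) (l : ledger) : ledger :=
  Ledger (stored l) (tosses l).+1 (peak l) (legal l && accessible cur l i).

Definition log_store (cur : option nat) (l : ledger) : ledger :=
  if cur is Some i then
    let M := if i \in stored l then stored l else i :: stored l in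
    Ledger M (tosses l) (maxn (peak l) (size M)) (legal l)
  else Ledger (stored l) (tosses l) (peak l) false.

Definition log_discard (i : nat) (l : ledger) : ledger :=
  Ledger (rem i (stored l)) (tosses l) (peak l) (legal l).

(* only coins in memory may be returned *)
Definition log_output (out : seq nat) (l : ledger) : ledger :=
  Ledger (stored l) (tosses l) (peak l)
         (legal l && all (mem (stored l)) out).

Section Semantics.
Context {R : realType}.

(* Finite distributions, as lists of (probability, outcome) pairs, one for each
   execution; an outcome may occur several times. *)
Definition fdist (A : Type) : Type := seq (R * A).

Definition fdist_scale A (w : R) (D : fdist A) : fdist A :=
  [seq (w * x.1, x.2) | x <- D].

Definition fdist_bind A B (D : fdist A) (f : A -> fdist B) : fdist B :=
  flatten [seq fdist_scale x.1 (f x.2) | x <- D].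

Definition Pr A (D : fdist A) (E : pred A) : R := \sum_(x <- D | E x.2) x.1.

Definition surely A (D : fdist A) (E : pred A) : bool :=
  all (fun x : R * A => E x.2) D.

(* Every toss of coin i is a fresh Bernoulli(p`_i) variable: whatever happened
   before, the probability of an execution is multiplied by the Bernoulli mass
   of the observed outcome. *)
Fixpoint exec (p : seq R) (cur : option nat) A (c : prog A) (l : ledger) :
    fdist (A * ledger) :=
  match c with
  | Ret a => [:: (1, (a, l))]
  | Toss i f =>
      fdist_scale (bernoulli_pmf p`_i true)
        (exec p cur (f true) (log_toss cur i l)) ++
      fdist_scale (bernoulli_pmf p`_i false)
        (exec p cur (f false) (log_toss cur i l))
  | StoreCurrent c' => exec p cur c' (log_store cur l)
  | Discard i c' => exec p cur c' (log_discard i l)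
  | Uniform m f =>
      flatten [seq fdist_scale m.+1%:R^-1 (exec p cur (f j) l)
                 | j <- enum 'I_m.+1]
  end.

Definition run_stream (alg : streaming_algorithm) (p : seq R) :
    fdist (state alg * ledger) :=
  foldl (fun D i => fdist_bind D
           (fun sl => exec p (Some i) (arrival sl.1) sl.2))
        [:: (1, (start alg, ledger0))] (iota 0 (size p)).

(* the joint distribution of the output and of the final ledger *)
Definition run (alg : streaming_algorithm) (p : seq R) :
    fdist (seq nat * ledger) :=
  fdist_bind (run_stream alg p) (fun sl =>
    [seq (x.1, (x.2.1, log_output x.2.1 x.2.2))
       | x <- exec p None (finish sl.1) sl.2]).

End Semantics.

(* Main.v *)
(** Idea. Keep k kings, each with an account measuring the evidence needed to
    dethrone it, and collect arriving coins in a buffer of k challengers. When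
    the buffer is full, toss all coins N = O(log(k/delta)/Delta^2) times and
    match the strongest challengers with the weakest kings, so that a good
    challenger (one of the top k) meets a bad king. In a duel both coins are
    tossed in rounds of N, with cumulative counts; the challenger must lead
    after every round until the account of the king is used up. A king that
    survives keeps what is left of its account plus two rounds, which makes the
    number of tosses linear in n on every execution. An exponential-moment
    bound shows that a good king with account A survives all bad challengers
    with probability at least 1 - lam^A, however many there are. Summing, over
    the top k coins, the risk lam^A of a king, delta/k for a coin not yet
    compared, and 1 for a lost coin, gives a supermartingale that starts at
    delta and is at least 1 upon failure. The preliminary matching may fail, but
    it only matters when the buffer contains a good coin, and then the risk
    delta/k of this coin pays for it. *)

Require Import Defs.
From mathcomp Require Import all_boot all_order all_algebra.
From mathcomp Require Import all_classical all_reals all_analysis.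
From mathcomp Require Import zify ring lra.

Set Implicit Arguments.
Unset Strict Implicit.
Unset Printing Implicit Defensive.

Import Order.TTheory GRing.Theory Num.Theory.
Local Open Scope ring_scope.

(** * Expectations and sure properties of programs *)

Fixpoint pbind A B (c : prog A) (f : A -> prog B) : prog B :=
  match c with
  | Ret a => f a
  | Toss i g => Toss i (fun b => pbind (g b) f)
  | StoreCurrent c' => StoreCurrent (pbind c' f)
  | Discard i c' => Discard i (pbind c' f)
  | Defs.Uniform m g => Defs.Uniform (fun j : 'I_m.+1 => pbind (g j) f)
  end.

Lemma all_flatten (T : Type) (a : pred T) (ss : seq (seq T)) :
  all a (flatten ss) = all (all a) ss.
Proof. by elim: ss => //= s ss IH; rewrite all_cat IH. Qed.

Section Expectation.
Context {R : realType}.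
Implicit Type p : seq R.

Definition expect A (D : fdist A) (F : A -> R) : R := \sum_(x <- D) x.1 * F x.2.

(* Expectation over the executions of a program of a function of its result;
   unlike [exec] it does not mention the ledger, on which results never
   depend. *)
Fixpoint ev p A (c : prog A) (F : A -> R) : R :=
  match c with
  | Ret a => F a
  | Toss i g => p`_i * ev p (g true) F + (1 - p`_i) * ev p (g false) F
  | StoreCurrent c' => ev p c' F
  | Discard _ c' => ev p c' F
  | Defs.Uniform m g => \sum_(j < m.+1) m.+1%:R^-1 * ev p (g j) F
  end.

Lemma expect_scale A (w : R) (D : fdist A) F :
  expect (fdist_scale w D) F = w * expect D F.
Proof.
by rewrite /expect big_map mulr_sumr; apply: eq_bigr => x _; rewrite mulrA.
Qed.

Lemma expect_cat A (D D' : fdist A) F :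
  expect (D ++ D') F = expect D F + expect D' F.
Proof. exact: big_cat. Qed.

Lemma expect_flatten A (s : seq (fdist A)) F :
  expect (flatten s) F = \sum_(D <- s) expect D F.
Proof. by rewrite /expect big_flatten. Qed.

Lemma expect_bind A B (D : fdist A) (f : A -> fdist B) F :
  expect (fdist_bind D f) F = expect D (fun a => expect (f a) F).
Proof.
rewrite expect_flatten big_map; apply: eq_bigr => x _; exact: expect_scale.
Qed.

Lemma expect_exec p cur A (c : prog A) l F :
  expect (exec p cur c l) (fun x => F x.1) = ev p c F.
Proof.
elim: c l => [a|i g IH|c IH|i c IH|m g IH] l /=.
- by rewrite /expect big_seq1 mul1r.
- by rewrite expect_cat !expect_scale !IH.
- exact: IH.
- exact: IH.
- rewrite expect_flatten big_map big_enum.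
  by apply: eq_bigr => j _; rewrite expect_scale IH.
Qed.

Lemma ev_pbind p A B (c : prog A) (f : A -> prog B) F :
  ev p (pbind c f) F = ev p c (fun a => ev p (f a) F).
Proof.
elim: c => [a|i g IH|c IH|i c IH|m g IH] //=; first by rewrite !IH.
by apply: eq_bigr => j _; rewrite IH.
Qed.

Lemma ev_cst p A (c : prog A) (a : R) : ev p c (fun=> a) = a.
Proof.
elim: c => [b|i g IH|c IH|i c IH|m g IH] //=.
  by rewrite !IH -mulrDl addrC subrK mul1r.
under eq_bigr do rewrite IH.
by rewrite sumr_const card_ord -[LHS]mulr_natl mulrA mulfV ?mul1r// pnatr_eq0.
Qed.

Lemma evD p A (c : prog A) F G :
  ev p c (fun a => F a + G a) = ev p c F + ev p c G.
Proof.
elim: c => [b|i g IH|c IH|i c IH|m g IH] //=.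
  by rewrite !IH; ring.
by rewrite -big_split; apply: eq_bigr => j _; rewrite IH mulrDr.
Qed.

Lemma evZ p A (c : prog A) (a : R) F :
  ev p c (fun x => a * F x) = a * ev p c F.
Proof.
elim: c => [b|i g IH|c IH|i c IH|m g IH] //=.
  by rewrite !IH; ring.
by rewrite mulr_sumr; apply: eq_bigr => j _; rewrite IH mulrCA.
Qed.

Lemma eq_ev p A (c : prog A) F G : F =1 G -> ev p c F = ev p c G.
Proof. by move=> /funext ->. Qed.

Lemma ev_sum p A (c : prog A) I (r : seq I) (P : pred I) (F : I -> A -> R) :
  ev p c (fun a => \sum_(i <- r | P i) F i a) =
  \sum_(i <- r | P i) ev p c (F i).
Proof.
elim: r => [|i r IH].
  by rewrite big_nil -[RHS](ev_cst p c); apply: eq_ev => a; rewrite big_nil.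
rewrite big_cons -IH; case: ifPn => Pi; last first.
  by apply: eq_ev => a; rewrite big_cons (negbTE Pi).
by rewrite -evD; apply: eq_ev => a; rewrite big_cons Pi.
Qed.

Section Biases.
Context p (p01 : forall i, 0 <= p`_i <= 1).

Lemma ev_le A (c : prog A) F G :
  (forall a, F a <= G a) -> ev p c F <= ev p c G.
Proof.
move=> FG; elim: c => [b|i g IH|c IH|i c IH|m g IH] //=.
  have /andP[pi0 pi1] := p01 i.
  by rewrite lerD// ler_wpM2l// subr_ge0.
by apply: ler_sum => j _; rewrite ler_wpM2l// invr_ge0 ler0n.
Qed.

Lemma exec_ge0 cur A (c : prog A) l :
  all (fun x => 0 <= x.1) (exec p cur c l).
Proof.
have scale_ge0 (w : R) (D : fdist (A * ledger)) :
    0 <= w -> all (fun x => 0 <= x.1) D ->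
    all (fun x => 0 <= x.1) (fdist_scale w D).
  by move=> w0; rewrite all_map; apply: sub_all => x; exact: mulr_ge0.
elim: c l => [a|i g IH|c IH|i c IH|m g IH] l //=.
- by rewrite ler01.
- have /andP[pi0 pi1] := p01 i.
  by rewrite all_cat !scale_ge0 ?IH ?subr_ge0.
- rewrite all_flatten all_map; apply/allP => j _ /=.
  by rewrite scale_ge0// invr_ge0 ler0n.
Qed.

Lemma bind_ge0 A B (D : fdist A) (f : A -> fdist B) :
  all (fun x : R * A => 0 <= x.1) D ->
  (forall a, all (fun x : R * B => 0 <= x.1) (f a)) ->
  all (fun x : R * B => 0 <= x.1) (fdist_bind D f).
Proof.
move=> D0 f0; rewrite all_flatten all_map.
apply: sub_all D0 => x x0 /=; rewrite all_map.
by apply: sub_all (f0 x.2) => y; exact: mulr_ge0.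
Qed.

End Biases.

(** Lets an invariant of the reachable states enter a comparison of expectations. *)
Lemma expect_le A (D : fdist A) (Q : pred A) F G :
  all (fun x : R * A => 0 <= x.1) D -> surely D Q ->
  (forall a, Q a -> F a <= G a) -> expect D F <= expect D G.
Proof.
move=> D0 DQ FG; elim: D D0 DQ => [|x D IH] /=; first by rewrite /expect !big_nil.
move=> /andP[x0 D0] /andP[Qx DQ]; rewrite /expect !big_cons.
by rewrite lerD ?ler_wpM2l ?FG// IH.
Qed.

Lemma surely_scale A (w : R) (D : @fdist R A) Q :
  surely (fdist_scale w D) Q = surely D Q.
Proof. exact: all_map. Qed.

Lemma surely_cat A (D D' : @fdist R A) Q :
  surely (D ++ D') Q = surely D Q && surely D' Q.
Proof. exact: all_cat. Qed.

Lemma surely_flatten A (s : seq (@fdist R A)) Q :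
  surely (flatten s) Q = all (fun D : @fdist R A => surely D Q) s.
Proof. by rewrite /surely all_flatten. Qed.

Lemma surely_bind A B (D : @fdist R A) (f : A -> @fdist R B) Q :
  surely (fdist_bind D f) Q = surely D (fun a => surely (f a) Q).
Proof.
by rewrite surely_flatten all_map; apply: eq_all => x; exact: surely_scale.
Qed.

Lemma surelyW A (D : @fdist R A) (Q Q' : pred A) :
  (forall a, Q a -> Q' a) -> surely D Q -> surely D Q'.
Proof. by move=> QQ'; apply: sub_all => x; exact: QQ'. Qed.

Lemma surely_pbind p cur A B (c : prog A) (f : A -> prog B) l Q :
  surely (exec p cur (pbind c f) l) Q =
  surely (exec p cur c l) (fun x => surely (exec p cur (f x.1) x.2) Q).
Proof.
elim: c l => [a|i g IH|c IH|i c IH|m g IH] l //=.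
- by rewrite /surely /= andbT.
- by rewrite !surely_cat !surely_scale !IH.
- rewrite !surely_flatten !all_map; apply: eq_all => j /=.
  by rewrite !surely_scale IH.
Qed.

Lemma surely_toss p cur A i (g : bool -> prog A) l Q :
  surely (exec p cur (Toss i g) l) Q =
  surely (exec p cur (g true) (log_toss cur i l)) Q &&
  surely (exec p cur (g false) (log_toss cur i l)) Q.
Proof. by rewrite surely_cat !surely_scale. Qed.

End Expectation.

(** * The algorithm *)

Fixpoint heads (i N : nat) : prog nat :=
  if N is N'.+1 then
    Toss i (fun b => pbind (heads i N') (fun h => Ret (b + h)%N))
  else Ret 0%N.

Fixpoint survey (N : nat) (s : seq nat) : prog (nat -> nat) :=
  if s is i :: s' then
    pbind (heads i N) (fun h => pbind (survey N s') (fun c =>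
      Ret (fun j => if j == i then h else c j)))
  else Ret (fun=> 0%N).

(* The king x and the challenger y have shown hx and hy heads so far, in the
   same number of tosses. The result is None if y outlasts the account A of x,
   and otherwise [Some f] where f is what remains of the account when y first
   fails to lead. *)
Fixpoint duel (N x y A hx hy : nat) : prog (option nat) :=
  if A is f.+1 then
    pbind (heads x N) (fun u => pbind (heads y N) (fun v =>
      if (hx + u < hy + v)%N then duel N x y f (hx + u) (hy + v)
      else Ret (Some f)))
  else Ret None.

(** Pairs are matched by position, so the sorting done beforehand decides who meets whom. In [f.+2]
    the round in which the challenger failed is already deducted; a new king starts with account
    1. *)
Fixpoint duels (N : nat) (K : seq (nat * nat)) (B : seq nat) :
    prog (seq (nat * nat)) :=
  match K, B with
  | (x, A) :: K', y :: B' =>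
      pbind (duel N x y A 0 0) (fun r =>
        if r is Some f then
          Discard y (pbind (duels N K' B') (fun K1 => Ret ((x, f.+2) :: K1)))
        else
          Discard x (pbind (duels N K' B') (fun K1 => Ret ((y, 1%N) :: K1))))
  | _, _ => Ret K
  end.

Definition weakest_first (c : nat -> nat) (K : seq (nat * nat)) :=
  sort (fun x y => c x.1 <= c y.1)%N K.

Definition strongest_first (c : nat -> nat) (B : seq nat) :=
  sort (fun x y => c y <= c x)%N B.

Definition merge_buffer (N : nat) (K : seq (nat * nat)) (B : seq nat) :
    prog (seq (nat * nat)) :=
  pbind (survey N (map fst K ++ B)) (fun c =>
    duels N (weakest_first c K) (strongest_first c B)).

Definition kings_buffer : Type := (nat * seq (nat * nat) * seq nat)%type.

(* The state (t, K, B) holds the number t of arrivals so far, which is the name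
   of the next coin, the kings K with their accounts, and the buffer B. *)
Definition kings_arrival (k N : nat) (s : kings_buffer) : prog kings_buffer :=
  let: (t, K, B) := s in
  StoreCurrent
    (if (size K < k)%N then Ret (t.+1, (t, 1%N) :: K, B)
     else if (size B).+1 == k then
       pbind (merge_buffer N K (t :: B)) (fun K' => Ret (t.+1, K', [::]))
     else Ret (t.+1, K, t :: B)).

Definition kings_finish (N : nat) (s : kings_buffer) : prog (seq nat) :=
  let: (t, K, B) := s in
  pbind (merge_buffer N K B) (fun K' => Ret (map fst K')).

Definition kings_algorithm (k N : nat) : streaming_algorithm :=
  StreamingAlgorithm ((0%N, [::], [::]) : kings_buffer)
    (kings_arrival k N) (kings_finish N).

(** The first [k] coins are crowned without contest, so challengers exist only once there are [k]
    kings. *)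
Definition wf (k : nat) (s : kings_buffer) : bool :=
  let: (t, K, B) := s in
  [&& uniq (map fst K ++ B), all (fun i => i < t)%N (map fst K ++ B),
      size K == minn t k, (size K < k)%N ==> (B == [::]) & (size B < k)%N].

(** * Matching challengers with kings *)

Section Matching.
Variables (good : pred nat) (c : nat -> nat).

(** A duel of two good coins always loses one of them, so this is the pairing to be avoided; two bad
    coins may meet. *)
Definition fair (K : seq (nat * nat)) (B : seq nat) : bool :=
  all (fun z => ~~ (good z.1.1 && good z.2)) (zip K B).

Lemma no_good_fair K B : ~~ has good B -> fair K B.
Proof.
elim: K B => [|[x A] K IH] [|y B] //=; rewrite negb_or => /andP[ybad Bbad].
by rewrite /fair /= (negbTE ybad) andbF; exact: IH.
Qed.

(** If the weakest king is good, then all kings are, and a good challenger would be one good coin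
    too many. If the strongest challenger is bad, then all challengers are. *)
Lemma sorted_fair K B :
  (forall i j, i \in map fst K ++ B -> j \in map fst K ++ B ->
     good i -> ~~ good j -> (c j < c i)%N) ->
  (count good (map fst K) + count good B <= size K)%N ->
  pairwise (fun x y : nat * nat => c x.1 <= c y.1)%N K ->
  pairwise (fun x y => c y <= c x)%N B -> fair K B.
Proof.
elim: K B => [|[x A] K IH] [|y B] //= sepc cnt /andP[xK sK] /andP[yB sB].
have xin : x \in x :: map fst K ++ y :: B by rewrite mem_head.
have yin : y \in x :: map fst K ++ y :: B.
  by rewrite in_cons mem_cat mem_head !orbT.
have Kin i : i \in map fst K -> i \in x :: map fst K ++ y :: B.
  by move=> iK; rewrite in_cons mem_cat iK orbT.
have Bin i : i \in B -> i \in x :: map fst K ++ y :: B.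
  by move=> iB; rewrite in_cons mem_cat in_cons iB !orbT.
have goodK : good x -> count good (map fst K) = size K.
  move=> gx; rewrite -(size_map fst K); apply/eqP; rewrite -all_count.
  apply/allP => i iK; apply/negPn/negP => gi.
  have := sepc _ _ xin (Kin _ iK) gx gi; rewrite ltnNge => /negP; apply.
  by move/mapP: iK => [z zK ->]; exact: (allP xK).
have badB : ~~ good y -> count good B = 0%N.
  move=> gy; apply/eqP; rewrite -leqn0 leqNgt -has_count; apply/hasPn => i iB.
  apply/negP => gi; have := sepc _ _ (Bin _ iB) yin gi gy.
  by rewrite ltnNge (allP yB).
rewrite /fair /= -/(fair K B); apply/andP; split.
  apply/negP => /andP[/= gx gy]; move: cnt.
  rewrite gx gy (goodK gx) /= !add1n -[X in (_ <= X)%N]addn0 leq_add2l.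
  by rewrite ltn0.
apply: IH => //.
- move=> i j; rewrite !mem_cat => iKB jKB; apply: sepc.
    by case/orP: iKB => [/Kin|/Bin].
  by case/orP: jKB => [/Kin|/Bin].
(* Dropping a good [y] compensates for the king dropped; if [y] is bad, no good challenger is
   left. *)
- have cntK := count_size good (map fst K); rewrite size_map in cntK.
  case gy: (good y) cnt badB => cnt badB; last by rewrite badB// addn0 ?cntK.
  rewrite add1n addnS ltnS in cnt; apply: leq_trans cnt.
  by rewrite leq_add2r leq_addl.
Qed.

Lemma sorting_fair K B :
  (forall i j, i \in map fst K ++ B -> j \in map fst K ++ B ->
     good i -> ~~ good j -> (c j < c i)%N) ->
  (count good (map fst K ++ B) <= size K)%N ->
  fair (weakest_first c K) (strongest_first c B).
Proof.
move=> sepc cnt.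
have memKB i : (i \in map fst (weakest_first c K) ++ strongest_first c B) =
    (i \in map fst K ++ B).
  rewrite !mem_cat mem_sort; congr orb; apply: perm_mem.
  by apply: perm_map; rewrite perm_sort.
apply: sorted_fair => [i j|||].
- rewrite !memKB; exact: sepc.
- rewrite size_sort -count_cat (permP (_ : perm_eq _ (map fst K ++ B)))//.
  by apply: perm_cat; [apply: perm_map|]; rewrite perm_sort.
- rewrite -sorted_pairwise; last by move=> x y z; exact: leq_trans.
  by apply: sort_sorted => x y; exact: leq_total.
- rewrite -sorted_pairwise; last by move=> x y z /[swap]; exact: leq_trans.
  by apply: sort_sorted => x y; exact: leq_total.
Qed.

End Matching.

(** * Failure probability *)

Section FailureProbability.
Context {R : realType}.
Variables (p : seq R) (p01 : forall i, 0 <= p`_i <= 1) (N : nat).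

Lemma ev_heads i (w : R) :
  ev p (heads i N) (fun h => w ^+ h) = (1 - p`_i + p`_i * w) ^+ N.
Proof.
elim: N => [|n IH] //=; rewrite !ev_pbind /= IH.
under eq_ev do rewrite exprS.
by rewrite evZ IH exprS; ring.
Qed.

(** Generating function of independent binomial counts. Distinctness matters: [survey] keeps only
    one count for a repeated coin. *)
Lemma ev_survey s (w : nat -> R) : uniq s ->
  ev p (survey N s) (fun c => \prod_(i <- s) w i ^+ c i) =
  \prod_(i <- s) (1 - p`_i + p`_i * w i) ^+ N.
Proof.
elim: s => [|i s IH] /=; first by rewrite !big_nil.
move=> /andP[si us]; rewrite ev_pbind big_cons -IH// -ev_heads.
rewrite [RHS]mulrC -evZ; apply: eq_ev => h; rewrite ev_pbind [RHS]mulrC -evZ.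
apply: eq_ev => c /=; rewrite big_cons eqxx; congr (_ * _).
apply: eq_big_seq => j js; case: eqP => // ji.
by rewrite -ji js in si.
Qed.

(* The left-hand side is the expectation of a ^+ (heads of j) / a ^+ (heads of i),
   which by Markov bounds the probability that j has at least as many heads. *)
Variables (good : pred nat) (a q lam : R).
Hypotheses (a1 : 1 <= a)
  (confident : forall i j, good i -> ~~ good j ->
    (1 - p`_j + p`_j * a) ^+ N * (1 - p`_i + p`_i * a^-1) ^+ N <= q).

Let a0 : 0 < a. Proof. exact: lt_le_trans a1. Qed.
Let an0 n : 0 < a ^+ n. Proof. by rewrite exprn_gt0. Qed.

Lemma survey_confident s i j : uniq s -> i \in s -> j \in s ->
  good i -> ~~ good j ->
  ev p (survey N s) (fun c => (c i <= c j)%N%:R) <= q.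
Proof.
move=> us si js gi gj; apply: le_trans (confident gi gj).
have ji : j != i by apply: contra gj => /eqP ->.
(* With these weights the product is [a ^+ c j / a ^+ c i], which dominates the indicator. *)
pose w l := if l == j then a else if l == i then a^-1 else 1.
have wj : w j = a by rewrite /w eqxx.
have wi : w i = a^-1 by rewrite /w eq_sym (negbTE ji) eqxx.
have w1 l : l != j -> l != i -> w l = 1.
  by rewrite /w => /negbTE -> /negbTE ->.
have -> : (1 - p`_j + p`_j * a) ^+ N * (1 - p`_i + p`_i * a^-1) ^+ N =
    ev p (survey N s) (fun c => \prod_(i <- s) w i ^+ c i).
  rewrite ev_survey// (bigD1_seq j)//= wj; congr (_ * _).
  rewrite -big_filter (bigD1_seq i) ?filter_uniq ?mem_filter ?si 1?eq_sym ?ji//=.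
  rewrite wi big_filter_cond big1 ?mulr1// => l /andP[lj li].
  by rewrite w1// mulr1 subrK expr1n.
apply: ev_le => // c.
rewrite (bigD1_seq j)//= wj.
rewrite -big_filter (bigD1_seq i) ?filter_uniq ?mem_filter ?si 1?eq_sym ?ji//=.
rewrite wi big_filter_cond big1 ?mulr1; last first.
  by move=> l /andP[lj li]; rewrite w1// expr1n.
case: leqP => [cij|_]; last by rewrite mulr_ge0// ltW// exprn_gt0// invr_gt0.
by rewrite exprVn ler_pdivlMr ?mul1r ?ler_weXn2l.
Qed.

(** The nesting follows [duel], which tosses the king first: here the king is the good coin, in
    [heads_confident_good] the challenger is. *)
Lemma heads_confident_bad i j : good i -> ~~ good j ->
  ev p (heads i N) (fun u => ev p (heads j N) (fun v => a ^+ v / a ^+ u)) <= q.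
Proof.
move=> gi gj; apply: le_trans (confident gi gj).
rewrite -ev_heads -[X in _ <= _ * X]ev_heads -evZ le_eqVlt; apply/orP; left.
apply/eqP; apply: eq_ev => u; rewrite mulrC -evZ; apply: eq_ev => v.
by rewrite exprVn mulrC.
Qed.

Lemma heads_confident_good i j : good i -> ~~ good j ->
  ev p (heads j N) (fun u => ev p (heads i N) (fun v => a ^+ u / a ^+ v)) <= q.
Proof.
move=> gi gj; apply: le_trans (confident gi gj).
rewrite mulrC -ev_heads -[X in _ <= _ * X]ev_heads -evZ.
rewrite le_eqVlt; apply/orP; left.
apply/eqP; apply: eq_ev => u; rewrite mulrC -evZ; apply: eq_ev => v.
by rewrite exprVn.
Qed.

Hypotheses (lam0 : 0 <= lam) (lam1 : lam <= 1 / 2) (q0 : 0 <= q)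
  (q_lam : q <= lam / 2).

(* The exponent f'.+2 is the account after the duel: lam ^+ (account) is a
   supermartingale along all the duels of a good king with bad coins. *)
Lemma duel_good_king x y f hx hy : good x -> ~~ good y -> (hx <= hy)%N ->
  ev p (duel N x y f hx hy) (fun r => if r is Some f' then lam ^+ f'.+2 else 1)
    <= lam ^+ f * (a ^+ hy / a ^+ hx).
Proof.
move=> gx gy; elim: f hx hy => [|f IH] hx hy hxy.
  by rewrite /= mul1r ler_pdivlMr// mul1r ler_weXn2l.
have r1 : 1 <= a ^+ hy / a ^+ hx by rewrite ler_pdivlMr// mul1r ler_weXn2l.
have r0 : 0 <= a ^+ hy / a ^+ hx by rewrite divr_ge0// ltW.
(* The first summand covers a duel that ends in this round, the second one that continues: the
   induction hypothesis applies to the updated ratio, and averaging over the round gains the factor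
   [q]. *)
apply: (@le_trans _ _ (lam ^+ f.+2 + (lam ^+ f * (a ^+ hy / a ^+ hx)) * q)).
  rewrite -[X in X + _](ev_cst p (heads x N)).
  apply: le_trans (lerD (lexx _) (ler_wpM2l _ (heads_confident_bad gx gy))).
    rewrite -evZ -evD /= ev_pbind; apply: ev_le => // u.
    rewrite -[X in X + _](ev_cst p (heads y N)) -evZ -evD ev_pbind.
    apply: ev_le => // v; rewrite fun_if /=.
    have -> : lam ^+ f * (a ^+ hy / a ^+ hx) * (a ^+ v / a ^+ u) =
        lam ^+ f * (a ^+ (hy + v) / a ^+ (hx + u)).
      by rewrite !exprD invfM; ring.
    case: ltnP => [lt|_].
      by rewrite (le_trans (IH _ _ (ltnW lt)))// lerDr exprn_ge0.
    by rewrite lerDl mulr_ge0 ?exprn_ge0// divr_ge0// ltW.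
  by rewrite mulr_ge0 ?exprn_ge0.
rewrite mulrAC -[X in X + _]mulr1 !exprS.
apply: le_trans (_ : (lam * (lam * lam ^+ f) + lam ^+ f * q) *
  (a ^+ hy / a ^+ hx) <= _).
  by rewrite mulrDl lerD// ler_wpM2l// !mulr_ge0 ?exprn_ge0.
rewrite ler_wpM2r//.
have -> : lam * (lam * lam ^+ f) + lam ^+ f * q = lam ^+ f * (lam * lam + q).
  by ring.
rewrite [leRHS]mulrC ler_wpM2l ?exprn_ge0//.
(* Both [lam * lam] and [q] are at most [lam / 2], so together they give back one factor [lam]. *)
have : lam * lam <= lam * (1 / 2) by rewrite ler_wpM2l.
by move: q_lam; lra.
Qed.

(** When the challenger ceases to lead, the ratio of powers of [a] is at least 1, while a round
    multiplies its expectation by at most [q]. The bound is uniform in [f], so a large account does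
    not protect a bad king. *)
Lemma duel_good_challenger x y f hx hy : ~~ good x -> good y ->
  ev p (duel N x y f hx hy) (fun r => (r : bool)%:R) <=
    2 * q * (a ^+ hx / a ^+ hy).
Proof.
move=> gx gy; elim: f hx hy => [|f IH] hx hy.
  by rewrite /= !mulr_ge0 ?invr_ge0 ?(ltW (an0 _)).
rewrite mulrAC /= ev_pbind.
apply: le_trans (ler_wpM2l _ (heads_confident_good gy gx)); last first.
  by rewrite !mulr_ge0 ?invr_ge0 ?(ltW (an0 _)).
rewrite -evZ; apply: ev_le => // u; rewrite -evZ ev_pbind.
apply: ev_le => // v.
have -> : 2 * (a ^+ hx / a ^+ hy) * (a ^+ u / a ^+ v) =
    2 * (a ^+ (hx + u) / a ^+ (hy + v)).
  by rewrite !exprD invfM; ring.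
case: ltnP => [_|vu] /=.
  apply: le_trans (IH _ _) _; rewrite ler_wpM2r ?divr_ge0 ?ltW//.
  by move: lam1 q_lam; lra.
rewrite -[leLHS]mulr1 ler_pM// ?ler1n// ler_pdivlMr// mul1r ler_weXn2l//.
Qed.

(** With distinct kings there is at most one factor; the empty product makes the risk of a coin that
    is not a king equal to 1. *)
Definition risk (K : seq (nat * nat)) (i : nat) : R :=
  \prod_(x <- K | x.1 == i) lam ^+ x.2.

Let lamX01 n : 0 <= lam ^+ n <= 1.
Proof. rewrite exprn_ge0//= exprn_ile1//; move: lam1; lra. Qed.

Lemma risk01 K i : 0 <= risk K i <= 1.
Proof.
rewrite /risk; elim/big_rec: _ => [|[x A] r _ /andP[r0 r1]].
  by rewrite ler01 lexx.
by have /andP[l0 l1] := lamX01 A; rewrite mulr_ge0//= mulr_ile1.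
Qed.

Lemma risk_cons x A K i :
  risk ((x, A) :: K) i = (if x == i then lam ^+ A else 1) * risk K i.
Proof. by rewrite /risk big_cons /=; case: ifP => // _; rewrite mul1r. Qed.

Lemma risk_lost K i : i \notin map fst K -> risk K i = 1.
Proof.
elim: K => [|[x A] K IH] /=; first by rewrite /risk big_nil.
rewrite in_cons negb_or eq_sym risk_cons => /andP[/negbTE -> /IH ->].
by rewrite mulr1.
Qed.

Lemma risk_perm K K' i : perm_eq K K' -> risk K i = risk K' i.
Proof. exact: perm_big. Qed.

Lemma ev_duels K B i : uniq (map fst K ++ B) -> (size B <= size K)%N ->
  fair good K B -> good i ->
  ev p (duels N K B) (risk^~ i) <= if i \in B then 2 * lam else risk K i.
Proof.
move=> + + + gi; elim: K B => [|[x A] K IH] [|y B] //=.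
rewrite mem_cat in_cons !negb_or -!andbA => /and4P[xK xy xB].
rewrite -cat1s uniq_catCA /= mem_cat negb_or -!andbA => /and3P[yK yB uKB] szB.
rewrite {1}/fair /= -/(fair good K B) negb_and => /andP[nxy fKB].
(* The remaining pairs play independently of the first duel, so their expected risk factors out. *)
pose E := ev p (duels N K B) (risk^~ i).
have /andP[E0 E1] : 0 <= E <= 1.
  rewrite -{1}(ev_cst p (duels N K B) 0) -{1}(ev_cst p (duels N K B) 1).
  by rewrite !ev_le// => K1; have /andP[] := risk01 K1 i.
pose g r : R := if r is Some f then if x == i then lam ^+ f.+2 else 1
  else if y == i then lam else 1.
have -> : ev p (pbind (duel N x y A 0 0) (fun r =>
      if r is Some f then
        Discard y (pbind (duels N K B) (fun K1 => Ret ((x, f.+2) :: K1)))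
      else
        Discard x (pbind (duels N K B) (fun K1 => Ret ((y, 1%N) :: K1)))))
    (risk^~ i) = E * ev p (duel N x y A 0 0) g.
  rewrite ev_pbind -evZ; apply: eq_ev => -[f|] /=; rewrite ev_pbind /=;
    by under eq_ev do rewrite risk_cons ?expr1; rewrite evZ mulrC.
have gE r : g r <= if x == i then if r is Some f then lam ^+ f.+2 else 1
                else if y == i then lam + (r : bool)%:R else 1.
  rewrite /g; case: eqVneq => [xi|_]; last first.
    by case: r => [f|]; case: ifP => // _ /=; rewrite ?lerDr ?addr0.
  by case: r => // ; case: ifP => // _; move: lam1; lra.
apply: le_trans (ler_wpM2l E0 (ev_le p01 _ gE)) _; rewrite risk_cons in_cons.
rewrite [i == y]eq_sym.
have [xi|xi] := eqVneq x i.
  subst i; rewrite eq_sym (negbTE xy) (negbTE xB) /= risk_lost// mulr1.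
  move: nxy; rewrite gi /= => nxy.
  apply: le_trans (ler_wpM2l E0 (duel_good_king A gi nxy (leqnn 0))) _.
  rewrite !expr0 divr1 mulr1 -[leRHS]mul1r ler_wpM2r//.
  by have /andP[] := lamX01 A.
have [yi|yi] := eqVneq y i.
  subst i; rewrite evD ev_cst /=; move: nxy; rewrite gi orbF => nx.
  have := duel_good_challenger A 0 0 nx gi; rewrite !expr0 divr1 mulr1 => le2q.
  apply: le_trans (ler_wpM2l E0 (lerD (lexx _) le2q)) _.
  (* A crowned challenger carries risk [lam], and [2 * q] bounds its chance of losing. *)
  have ll : lam + 2 * q <= 2 * lam by move: q_lam; lra.
  rewrite -[leRHS]mul1r ler_pM// addr_ge0// mulr_ge0//.
by rewrite ev_cst mulr1 mul1r; apply: IH.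
Qed.

(** An unfair matching requires a good challenger and a good-bad pair in the wrong order. The union
    bound runs over at most [size K] good coins and [2 * size K] coins in all. *)
Lemma ev_merge K B i : uniq (map fst K ++ B) -> (size B <= size K)%N ->
  (count good (map fst K ++ B) <= size K)%N -> good i ->
  ev p (merge_buffer N K B) (risk^~ i) <=
  (if i \in B then 2 * lam else risk K i) +
  (has good B)%:R * ((2 * size K ^ 2)%:R * q).
Proof.
set s := map fst K ++ B => us szB cnt gi.
set bound := if i \in B then _ else _.
have b0 : 0 <= bound.
  by rewrite /bound; case: ifP => _; [rewrite mulr_ge0|case/andP: (risk01 K i)].
pose swaps (c : nat -> nat) : R :=
  \sum_(x <- s | good x) \sum_(y <- s | ~~ good y) (c x <= c y)%N%:R.
have swaps0 c : 0 <= swaps c by rewrite !sumr_ge0// => x _; rewrite sumr_ge0.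
have permK c : perm_eq (weakest_first c K) K by rewrite perm_sort.
have permB c : perm_eq (strongest_first c B) B by rewrite perm_sort.
have le_swaps c : ev p (duels N (weakest_first c K) (strongest_first c B))
    (risk^~ i) <= bound + (has good B)%:R * swaps c.
  have ev1 D : ev p D (risk^~ i) <= 1.
    rewrite -[leRHS](ev_cst p D); apply: ev_le => // K'.
    by case/andP: (risk01 K' i).
  have fair_le : fair good (weakest_first c K) (strongest_first c B) ->
      ev p (duels N (weakest_first c K) (strongest_first c B)) (risk^~ i)
        <= bound.
    move=> fairKB; rewrite /bound -(perm_mem (permB c)).
    rewrite -(risk_perm i (permK c)); apply: ev_duels => //.
      rewrite (perm_uniq (_ : perm_eq _ s))//.
      by rewrite perm_cat// perm_map.
    by rewrite !size_sort.
  have [goodB|badB] := boolP (has good B); last first.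
    rewrite mul0r addr0; apply/fair_le/no_good_fair.
    by rewrite (perm_has good (permB c)).
  rewrite mul1r.
  have [fairKB|unfair] :=
      boolP (fair good (weakest_first c K) (strongest_first c B)).
    by rewrite (le_trans (fair_le fairKB))// lerDl.
  apply: le_trans (ev1 _) _; rewrite -[leLHS]add0r lerD//.
  have [x [y [xs ys gx gy cxy]]] : exists x y,
      [/\ x \in s, y \in s, good x, ~~ good y & (c x <= c y)%N].
    apply: contrapT => none; move/negP: unfair; apply.
    apply: sorting_fair => // x y xs ys gx gy; rewrite ltnNge.
    by apply/negP => cxy; apply: none; exists x, y.
  rewrite /swaps (big_rem x)//= gx (big_rem y)//= gy cxy -addrA lerDl.
  rewrite addr_ge0 ?sumr_ge0// => z _; rewrite sumr_ge0//.
rewrite /merge_buffer ev_pbind; apply: le_trans (ev_le p01 (survey N s) le_swaps) _.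
rewrite evD ev_cst evZ lerD// ler_wpM2l// /swaps ev_sum.
apply: (@le_trans _ _ (\sum_(x <- s | good x) \sum_(y <- s) q)).
  rewrite big_seq_cond [leRHS]big_seq_cond; apply: ler_sum => x /andP[xs gx].
  rewrite ev_sum big_seq_cond [leRHS]big_seq [leRHS](bigID (fun y => ~~ good y)) /=.
  rewrite -[leLHS]addr0 lerD ?sumr_ge0// ler_sum// => y /andP[ys gy].
  exact: survey_confident.
under eq_bigr do rewrite big_const_seq iter_addr_0 count_predT.
rewrite big_const_seq iter_addr_0 -mulrnA -[leLHS]mulr_natl ler_wpM2r// ler_nat.
by rewrite size_cat size_map -mulnn mulnA leq_mul// mul2n -addnn leq_add2l.
Qed.

Variables (G : seq nat) (mu : R).
Hypotheses (goodE : good =1 mem G)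
  (mu_ge : 2 * lam + (size G * (2 * size G ^ 2))%:R * q <= mu).


(* Coin i carries the risk mu until it has been compared with the kings. *)
Definition potential (t : nat) (K : seq (nat * nat)) (B : seq nat) : R :=
  \sum_(i <- G) if (t <= i)%N || (i \in B) then mu else risk K i.

(** A failed matching may add [e] to the risk of every good coin. As this requires a good coin in
    the buffer, the total [size G * e] is charged to that coin, whose share falls from [mu] to
    [2 * lam]. *)
Lemma potential_merge t K B :
  uniq (map fst K ++ B) -> all (fun i => i < t)%N (map fst K ++ B) ->
  size K = size G -> (size B <= size K)%N ->
  ev p (merge_buffer N K B) (fun K' => potential t K' [::]) <= potential t K B.
Proof.
move=> us lt_t szK szB; rewrite ev_sum.
set e := (2 * size K ^ 2)%:R * q.
have e0 : 0 <= e by rewrite mulr_ge0.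
have cnt : (count good (map fst K ++ B) <= size K)%N.
  rewrite szK -size_filter uniq_leq_size ?filter_uniq// => i.
  by rewrite mem_filter goodE => /andP[].
have kmu : 2 * lam + (size G)%:R * e <= mu.
  by move: mu_ge; rewrite natrM -mulrA /e szK.
pose extra i := if i \in B then (size G)%:R * e else 0.
pose base i := if (t <= i)%N then mu else if i \in B then 2 * lam else risk K i.
apply: (@le_trans _ _ (\sum_(i <- G) (base i + (has good B)%:R * e))).
  rewrite big_seq [leRHS]big_seq; apply: ler_sum => i iG.
  rewrite in_nil orbF /base; case: ifP => _.
    by rewrite ev_cst lerDl mulr_ge0.
  by apply: ev_merge; rewrite ?goodE.
apply: (@le_trans _ _ (\sum_(i <- G) (base i + extra i))).
  rewrite !big_split lerD//= big_const_seq iter_addr_0 count_predT.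
  rewrite -[leLHS]mulr_natl mulrCA.
  have ex0 i : 0 <= extra i by rewrite /extra; case: ifP => // _; rewrite mulr_ge0.
  have [/hasP[i iB gi]|_] := boolP (has good B); last first.
    by rewrite mul0r sumr_ge0.
  rewrite goodE in gi; rewrite mul1r (big_rem i)//= {1}/extra iB lerDl.
  by rewrite sumr_ge0.
apply: ler_sum => i _; rewrite /base /extra.
have [iB|_] := boolP (i \in B).
  have it : (i < t)%N by apply: (allP lt_t); rewrite mem_cat iB orbT.
  by rewrite leqNgt it.
by rewrite orbF addr0.
Qed.

Lemma potential_arrival s : wf (size G) s ->
  ev p (kings_arrival (size G) N s) (fun s' => potential s'.1.1 s'.1.2 s'.2) <=
  potential s.1.1 s.1.2 s.2.
Proof.
move: s => [[t K] B] /and5P[us lt_t /eqP szK BE szB] /=.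
have tn : t \notin map fst K ++ B.
  by apply/negP => /(allP lt_t); rewrite ltnn.
have next i : i != t -> (t.+1 <= i)%N = (t <= i)%N.
  by move=> it; rewrite ltn_neqAle eq_sym it.
have [ltK|geK] := ltnP (size K) (size G).
  apply: ler_sum => i _ /=; rewrite risk_cons.
  have [->|it] := eqVneq i t.
    (* A coin crowned on arrival exchanges [mu] for [lam]. *)
    rewrite ltnn leqnn expr1.
    move: tn; rewrite mem_cat negb_or => /andP[tK /negbTE ->].
    rewrite risk_lost// mulr1; apply: le_trans mu_ge.
    rewrite -[leLHS]addr0 lerD ?mulr_ge0//; move: lam0; lra.
  by rewrite next// mul1r.
have le_buffer : potential t.+1 K (t :: B) <= potential t K B.
  apply: ler_sum => i _; rewrite in_cons.
  by have [->|it] := eqVneq i t; rewrite /= ?leqnn ?orbT ?next.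
case: ifP => [/eqP szB1|_ //].
rewrite ev_pbind /=; apply: le_trans le_buffer.
have szKG : size K = size G by apply/eqP; rewrite eqn_leq geK szK geq_minr.
apply: potential_merge => //.
- by rewrite -cat1s uniq_catCA /= tn.
- rewrite -cat1s all_cat /= ltnSn andTb -all_cat.
  by apply: sub_all lt_t => i /ltnW.
- by rewrite /= szB1 szKG.
Qed.

End FailureProbability.

(** * Tosses, memory and legality *)

Section Resources.
Context {R : realType}.
Variables (p : seq R) (cur : option nat) (N : nat).

(** This and the following rules are in continuation style: [Q] holds surely if it holds for all
    results and ledgers described by the premise. *)
Lemma surely_heads i S T P (Q : pred (nat * ledger)) : i \in S ->
  (forall h, Q (h, Ledger S (T + N) P true)) ->
  surely (exec p cur (heads i N) (Ledger S T P true)) Q.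
Proof.
move=> iS; elim: N T Q => [|n IH] T Q HQ.
  by have := HQ 0%N; rewrite addn0 /surely /= => ->.
rewrite surely_toss !surely_pbind /log_toss /accessible /= iS orbT.
by apply/andP; split; apply: IH => h;
  rewrite (addSnnS T) /surely /= HQ.
Qed.

Lemma surely_survey s S T P (Q : pred ((nat -> nat) * ledger)) :
  {subset s <= S} ->
  (forall c, Q (c, Ledger S (T + N * size s) P true)) ->
  surely (exec p cur (survey N s) (Ledger S T P true)) Q.
Proof.
elim: s T Q => [|i s IH] T Q sS HQ.
  by have := HQ (fun=> 0%N); rewrite muln0 addn0 /surely /= => ->.
rewrite surely_pbind; apply: surely_heads; first by rewrite sS// mem_head.
move=> h; rewrite surely_pbind; apply: IH => [j js|c].
  by rewrite sS// in_cons js orbT.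
by rewrite /surely /= -addnA -mulnS HQ.
Qed.

(** A round costs [2 * N] tosses and one unit of the account, so tosses plus [2 * N] times the
    account are conserved; [None] means that nothing is left. *)
Lemma surely_duel x y f hx hy S T P (Q : pred (option nat * ledger)) :
  x \in S -> y \in S ->
  (forall r T', (T' + 2 * N * odflt 0 r = T + 2 * N * f)%N ->
     Q (r, Ledger S T' P true)) ->
  surely (exec p cur (duel N x y f hx hy) (Ledger S T P true)) Q.
Proof.
move=> xS yS; elim: f hx hy T Q => [|f IH] hx hy T Q HQ.
  by rewrite /surely /= HQ.
rewrite surely_pbind; apply: surely_heads => // u.
rewrite surely_pbind; apply: surely_heads => // v /=.
case: ifP => _; last by rewrite /surely /= HQ//=; lia.
by apply: IH => r T' T'E; apply: HQ; lia.
Qed.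

Definition accounts (K : seq (nat * nat)) : nat := sumn (map snd K).

(** [Z] collects the stored coins outside the remaining pairs, such as the winners so far. Each
    challenger brings at most two new units into the accounts. *)
Lemma surely_duels K B Z S T P (Q : pred (seq (nat * nat) * ledger)) :
  uniq S -> perm_eq S (map fst K ++ B ++ Z) -> (size B <= size K)%N ->
  (forall K' S' T', uniq S' -> perm_eq S' (map fst K' ++ Z) ->
     {subset S' <= S} -> size K' = size K ->
     (T' + 2 * N * accounts K' <= T + 2 * N * (accounts K + 2 * size B))%N ->
     Q (K', Ledger S' T' P true)) ->
  surely (exec p cur (duels N K B) (Ledger S T P true)) Q.
Proof.
elim: K B Z S T Q => [|[x A] K IH] [|y B] Z S T Q uS permS szB HQ //.
- by rewrite /surely /= HQ//= muln0 addn0.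
- by rewrite /surely /= HQ//= muln0 addn0.
have xS : x \in S by rewrite (perm_mem permS) mem_head.
have yS : y \in S by rewrite (perm_mem permS) !(mem_cat, in_cons) eqxx !orbT.
have permx : perm_eq (rem x S) (map fst K ++ B ++ y :: Z).
  apply/permP => e; have := permP permS e; have := permP (perm_to_rem xS) e.
  by rewrite /= !count_cat /= !count_cat /=; lia.
have permy : perm_eq (rem y S) (map fst K ++ B ++ x :: Z).
  apply/permP => e; have := permP permS e; have := permP (perm_to_rem yS) e.
  by rewrite /= !count_cat /= !count_cat /=; lia.
rewrite surely_pbind; apply: surely_duel => // -[f|] T' T'E /=.
  rewrite surely_pbind; apply: IH permy _ _; rewrite ?rem_uniq//.
  move=> K1 S1 T1 uS1 permS1 subS1 szK1 T1E; rewrite /surely /= HQ//=.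
  - by apply/permP => e; rewrite (permP permS1 e) /= !count_cat /=; lia.
  - by move=> i /subS1/mem_rem.
  - by rewrite szK1.
  - move: T1E T'E; rewrite /accounts /=; lia.
rewrite surely_pbind; apply: IH permx _ _; rewrite ?rem_uniq//.
move=> K1 S1 T1 uS1 permS1 subS1 szK1 T1E; rewrite /surely /= HQ//=.
- by apply/permP => e; rewrite (permP permS1 e) /= !count_cat /=; lia.
- by move=> i /subS1/mem_rem.
- by rewrite szK1.
- move: T1E T'E; rewrite /accounts /=; lia.
Qed.

Lemma surely_merge K B S T P (Q : pred (seq (nat * nat) * ledger)) :
  uniq S -> perm_eq S (map fst K ++ B) -> (size B <= size K)%N ->
  (forall K' S' T', uniq S' -> perm_eq S' (map fst K') ->
     {subset S' <= S} -> size K' = size K ->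
     (T' + 2 * N * accounts K' <=
        T + N * (size K + size B) + 2 * N * (accounts K + 2 * size B))%N ->
     Q (K', Ledger S' T' P true)) ->
  surely (exec p cur (merge_buffer N K B) (Ledger S T P true)) Q.
Proof.
move=> uS permS szB HQ; rewrite surely_pbind; apply: surely_survey => [i|c].
  by rewrite (perm_mem permS).
have permK : perm_eq (weakest_first c K) K by rewrite perm_sort.
have permB : perm_eq (strongest_first c B) B by rewrite perm_sort.
apply: (@surely_duels _ _ [::]) => //.
- by rewrite cats0 (perm_trans permS)// perm_sym perm_cat// perm_map.
- by rewrite !size_sort.
move=> K' S' T' uS'; rewrite cats0 !size_sort => permS' subS' szK' T'E.
apply: HQ => //; move: T'E.
by rewrite /accounts (perm_sumn (perm_map snd permK)) size_cat size_map.
Qed.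

(** Amortised count: each arrival brings [6 * N]. A buffered coin saves it for its merge, where a
    full buffer needs [2 * N] per challenger for the survey and [4 * N] for two account units. *)
Definition inv (k : nat) (x : kings_buffer * ledger) : bool :=
  let: (t, K, B) := x.1 in
  [&& wf k x.1, legal x.2, uniq (stored x.2),
      perm_eq (stored x.2) (map fst K ++ B), (peak x.2 <= 2 * k)%N &
      (tosses x.2 + 2 * N * accounts K + 6 * N * size B <= 6 * N * t)%N].

End Resources.

Lemma inv_arrival (R : realType) (p : seq R) N k t K B l :
  inv N k (t, K, B, l) ->
  surely (exec p (Some t) (kings_arrival k N (t, K, B)) l)
    (fun x => (x.1.1.1 == t.+1) && inv N k x).
Proof.
case: l => S T P L /andP[/and5P[uKB lt_t /eqP szK BE szB]].
move=> /and5P[/= -> uS permS leP leT].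
have tKB : t \notin map fst K ++ B.
  by apply/negP => /(allP lt_t); rewrite ltnn.
have tS : t \notin S by rewrite (perm_mem permS).
rewrite (negbTE tS) /=.
have szS : size S = (size K + size B)%N.
  by rewrite (perm_size permS) size_cat size_map.
have szKk : (size K <= k)%N by rewrite szK geq_minr.
have leP' : (maxn P (size S).+1 <= 2 * k)%N by rewrite geq_max leP szS; lia.
have lt_t1 : all (fun i => i < t.+1)%N (map fst K ++ B).
  by apply: sub_all lt_t => i /ltnW.
have uS' : uniq (t :: S) by rewrite /= tS.
have permS' : perm_eq (t :: S) (map fst K ++ t :: B).
  by rewrite -(cat1s t B) perm_sym perm_catCA perm_cons perm_sym.
have uKB' : uniq (map fst K ++ t :: B) by rewrite -(perm_uniq permS').
have lt_t1' : all (fun i => i < t.+1)%N (map fst K ++ t :: B).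
  by rewrite -cat1s all_cat /= ltnSn andTb -all_cat.
case: ltnP => [ltK|geK].
  move: BE; rewrite ltK => /eqP B0; subst B.
  rewrite cats0 in permS tKB uKB lt_t1.
  rewrite /surely /= /inv /= cats0 eqxx tKB uKB ltnSn lt_t1 tS uS leP' szB.
  rewrite perm_cons permS implybT /= !andbT; apply/andP; split.
    by apply/eqP; move: szK ltK; clear; lia.
  by move: leT; rewrite /accounts /=; clear; lia.
have szKE : size K = k by apply/eqP; rewrite eqn_leq szKk.
have kt : k == minn t.+1 k.
  by rewrite eq_sym; apply/eqP/minn_idPr; rewrite leqW// -szKE szK geq_minl.
case: ifP => [/eqP szB1|/negbT szB1].
  rewrite surely_pbind; apply: surely_merge => //.
    by rewrite /= szB1 szKE.
  move=> K' S' T' uS1 permS1 subS1 szK' leT'.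
  rewrite /surely /= /inv /= cats0 -(perm_uniq permS1) uS1 eqxx permS1 leP' /=.
  rewrite implybT szK' szKE.
  have -> : all (fun i => i < t.+1)%N (map fst K').
    apply/allP => i; rewrite -(perm_mem permS1) => /subS1.
    by rewrite (perm_mem permS'); exact: (allP lt_t1').
  rewrite kt (leq_ltn_trans _ szB)//= muln0 addn0.
  move: leT leT'; rewrite /= szKE -szB1; clear; lia.
rewrite /surely /= /inv /= eqxx uKB' lt_t1' permS' tS uS leP' /=.
rewrite szKE ltnn /= ltn_neqAle szB1 szB kt /=.
by move: leT => /=; clear; lia.
Qed.

(** * The whole stream *)

Section Run.
Context {R : realType}.
Variables (p : seq R) (p01 : forall i, 0 <= p`_i <= 1) (N : nat).
Variables (good : pred nat) (a q lam mu : R) (G : seq nat).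
Hypotheses (a1 : 1 <= a)
  (confident : forall i j, good i -> ~~ good j ->
    (1 - p`_j + p`_j * a) ^+ N * (1 - p`_i + p`_i * a^-1) ^+ N <= q)
  (lam0 : 0 <= lam) (lam1 : lam <= 1 / 2) (q0 : 0 <= q) (q_lam : q <= lam / 2)
  (uG : uniq G) (goodE : good =1 mem G)
  (mu_ge : 2 * lam + (size G * (2 * size G ^ 2))%:R * q <= mu)
  (G_gt0 : (0 < size G)%N) (G_lt : all (fun i => i < size p)%N G).

Let k := size G.
Let phi (s : kings_buffer) : R := potential lam G mu s.1.1 s.1.2 s.2.

Let step (D : fdist (kings_buffer * ledger)) i : fdist (kings_buffer * ledger) :=
  fdist_bind D (fun sl => exec p (Some i) (kings_arrival k N sl.1) sl.2).

Let stream m := foldl step [:: (1, ((0%N, [::], [::]), ledger0))] (iota 0 m).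

Let streamS m : stream m.+1 = step (stream m) m.
Proof. by rewrite /stream -addn1 iotaD foldl_cat. Qed.

Lemma stream_ge0 m : all (fun x => 0 <= x.1) (stream m).
Proof.
elim: m => [|m IH]; first by rewrite /stream /= ler01.
by rewrite streamS; apply: bind_ge0 => // sl; exact: exec_ge0.
Qed.

Lemma stream_inv m :
  surely (stream m) (fun x => (x.1.1.1 == m) && inv N k x).
Proof.
elim: m => [|m IH].
  by rewrite /surely /= /inv /= /accounts /= min0n G_gt0 implybT !muln0.
rewrite streamS surely_bind; apply: surelyW IH => -[[[t K] B] l].
by move=> /andP[/eqP /= -> invx]; exact: inv_arrival.
Qed.

Lemma stream_mass m : expect (stream m) (fun=> 1) = 1.
Proof.
elim: m => [|m IH]; first by rewrite /expect big_seq1 mulr1.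
rewrite streamS expect_bind -[RHS]IH; congr expect; apply/funext => sl.
by rewrite (expect_exec _ _ _ _ (fun=> 1)) ev_cst.
Qed.

Lemma stream_potential m : expect (stream m) (fun x => phi x.1) <= k%:R * mu.
Proof.
elim: m => [|m IH].
  (* Before the first arrival each of the [k] good coins contributes [mu]. *)
  rewrite /expect big_seq1 mul1r /phi /potential /=.
  by rewrite big_const_seq iter_addr_0 count_predT -[leLHS]mulr_natl.
rewrite streamS expect_bind; apply: le_trans IH.
apply: (expect_le (stream_ge0 m) (stream_inv m)) => -[s l] /andP[_ invs].
rewrite expect_exec.
apply: (potential_arrival p01 a1 confident lam0 lam1 q0 q_lam goodE mu_ge).
by case: s invs => [[t K] B] /andP[].
Qed.

(** The last buffer may be nearly empty and cannot pay for surveying all kings; this extra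
    [N * k <= N * t] raises 6 to 7. *)
Lemma inv_finish t K B l : inv N k (t, K, B, l) -> (k <= t)%N ->
  surely (exec p None (merge_buffer N K B) l) (fun x =>
    [&& uniq (map fst x.1), size x.1 == k, perm_eq (stored x.2) (map fst x.1),
        (tosses x.2 <= 7 * N * t)%N, (peak x.2 <= 2 * k)%N & legal x.2]).
Proof.
case: l => S T P L /andP[/and5P[uKB lt_t /eqP szK _ szB]].
move=> /and5P[/= -> uS permS leP leT] kt.
have szKk : size K = k by rewrite szK; apply/minn_idPr.
apply: surely_merge => //; first by rewrite szKk ltnW.
move=> K' S' T' uS' permS' _ szK' leT' /=.
rewrite -(perm_uniq permS') uS' szK' szKk eqxx permS' leP !andbT /=.
have : (N * k <= N * t)%N by rewrite leq_mul.
move: leT leT'; rewrite szKk; clear.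
by move: (accounts K) (accounts K') (size B) k => A A' b r; lia.
Qed.

Lemma ev_finish t K B l : inv N k (t, K, B, l) -> (k <= t)%N ->
  (size p <= t)%N ->
  ev p (kings_finish N (t, K, B)) (fun out => (~~ perm_eq out G)%:R) <=
  phi (t, K, B).
Proof.
move=> invl kt pt; rewrite ev_pbind /=.
have [uKB lt_t szK szB] : [/\ uniq (map fst K ++ B),
    all (fun i => i < t)%N (map fst K ++ B), size K = k & (size B <= size K)%N].
  case/andP: invl => /and5P[uKB lt_t /eqP szK _ szB] _.
  have szKk : size K = k by rewrite szK; apply/minn_idPr.
  by split=> //; rewrite szKk ltnW.
apply: le_trans (potential_merge p01 a1 confident lam0 lam1 q0 q_lam goodE
  mu_ge uKB lt_t szK szB).
rewrite -!(expect_exec _ None _ l).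
apply: (expect_le (exec_ge0 p01 None _ l) (inv_finish invl kt)) => -[K' l'].
move=> /and3P[/= uK' /eqP szK' _].
have riskE i : i \in G ->
    (if (t <= i)%N || (i \in [::]) then mu else risk lam K' i) = risk lam K' i.
  by move=> /(allP G_lt) iG; rewrite leqNgt (leq_trans iG).
rewrite /potential (eq_big_seq _ riskE).
have risk0 i : 0 <= risk lam K' i by case/andP: (risk01 lam0 lam1 K' i).
have [_|notperm] := boolP (perm_eq _ G); first by rewrite sumr_ge0.
(* There are exactly [k] distinct kings, so a wrong output misses a coin of [G], whose risk is then
   1. *)
have [i iG iK'] : exists2 i, i \in G & i \notin map fst K'.
  apply: contrapT => none; move/negP: notperm; apply.
  rewrite perm_sym; apply: uniq_perm => //.
  have sub : {subset G <= map fst K'}.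
    by move=> i iG; apply/negPn/negP => iK'; apply: none; exists i.
  by have [] := uniq_min_size uG sub; rewrite ?size_map ?szK'.
by rewrite (big_rem i)//= (risk_lost _ iK') lerDl sumr_ge0.
Qed.

Lemma kings_run (D := run (kings_algorithm k N) p) : (k <= size p)%N ->
  [/\ 1 - k%:R * mu <= Pr D (fun x => perm_eq x.1 G),
      surely D (fun x => (tosses x.2 <= 7 * N * size p)%N),
      surely D (fun x => (peak x.2 <= 2 * k)%N) &
      surely D (fun x => legal x.2)].
Proof.
move=> kp.
have runE F : expect D F = expect (stream (size p)) (fun sl =>
    expect (exec p None (kings_finish N sl.1) sl.2)
      (fun x => F (x.1, log_output x.1 x.2))).
  rewrite /D /run expect_bind; congr expect; apply/funext => sl.
  by rewrite /expect big_map.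
have expectD F : expect D (fun x => F x.1) =
    expect (stream (size p)) (fun sl => ev p (kings_finish N sl.1) F).
  by rewrite runE; congr expect; apply/funext => sl; rewrite expect_exec.
have surelyD (Q : pred (seq nat * ledger)) :
    (forall out l, perm_eq (stored l) out -> (tosses l <= 7 * N * size p)%N ->
      (peak l <= 2 * k)%N -> legal l -> Q (out, log_output out l)) ->
    surely D Q.
  move=> HQ; rewrite /D /run surely_bind.
  apply: surelyW (stream_inv (size p)) => -[[[t K] B] l] /andP[/eqP /= tE invl].
  rewrite [surely _ _](_ : _ = surely (exec p None (kings_finish N (t, K, B)) l)
    (fun x => Q (x.1, log_output x.1 x.2))); last by rewrite /surely all_map.
  rewrite surely_pbind.
  rewrite tE in invl; apply: surelyW (inv_finish invl kp) => -[K' l'] /=.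
  move=> /andP[_ /and5P[_ permS leT leP legall]].
  by rewrite /surely /= andbT; exact: HQ.
split; try by apply: surelyD.
  (* The total mass is 1, so it suffices to bound the failure probability. *)
  have -> : Pr D (fun x => perm_eq x.1 G) =
      1 - expect D (fun x => (~~ perm_eq x.1 G)%:R).
    rewrite -[X in X - _](stream_mass (size p)).
    have -> : expect (stream (size p)) (fun=> 1) = expect D (fun=> 1).
      rewrite (expectD (fun=> 1)); congr expect; apply/funext => sl.
      by rewrite ev_cst.
    rewrite /Pr /expect -sumrB big_mkcond /=; apply: eq_bigr => x _.
    by case: perm_eq; rewrite !mulr1 ?mulr0 ?subr0 ?subrr.
  rewrite lerD2l lerNl opprK (expectD (fun out => (~~ perm_eq out G)%:R)).
  apply: le_trans (stream_potential (size p)).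
  apply: (expect_le (stream_ge0 _) (stream_inv _)) => -[[[t K] B] l].
  move=> /andP[/eqP /= tE invl]; rewrite tE in invl *.
  exact: ev_finish invl kp (leqnn _).
apply: surelyD => out l permS _ _ legall; rewrite /= legall.
by apply/allP => i; rewrite -(perm_mem permS).
Qed.

End Run.

(** * The top coins and their gap *)

Section Ranking.
Context {R : realType}.
Implicit Type p : seq R.

Let geb p : rel nat := fun i j => p`_j <= p`_i.

Lemma ranking_sorted p : sorted (geb p) (ranking p).
Proof. by apply: sort_sorted => i j; exact: le_total. Qed.

Lemma size_ranking p : size (ranking p) = size p.
Proof. by rewrite size_sort size_iota. Qed.

Lemma top_coinsE k p : (k <= size p)%N -> top_coins k p = take k (ranking p).
Proof.
move=> kp; rewrite /top_coins -[1%N]addn0 iotaDl -map_comp.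
by rewrite -(map_nth_iota0 0%N) ?size_ranking.
Qed.

Lemma top_coins_uniq k p : (k <= size p)%N -> uniq (top_coins k p).
Proof. by move=> kp; rewrite top_coinsE// take_uniq// sort_uniq iota_uniq. Qed.

Lemma size_top_coins k p : size (top_coins k p) = k.
Proof. by rewrite size_map size_iota. Qed.

Lemma top_coins_lt k p : (k <= size p)%N ->
  all (fun i => i < size p)%N (top_coins k p).
Proof.
move=> kp; apply/allP => i; rewrite top_coinsE// => /mem_take.
by rewrite mem_sort mem_iota.
Qed.

Lemma ranked_bias_anti p i j : (0 < i <= j)%N -> (j <= size p)%N ->
  ranked_bias p j <= ranked_bias p i.
Proof.
move=> /andP[i0 ij] jp.
have geb_trans : transitive (geb p) by move=> x y z /[swap]; exact: le_trans.
have geb_refl : reflexive (geb p) by move=> x; exact: lexx.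
apply: (sorted_leq_nth geb_trans geb_refl 0%N (ranking_sorted p));
  rewrite ?inE ?size_ranking; lia.
Qed.

Lemma gap_top_coins k p i j : (0 < k < size p)%N -> (forall l, 0 <= p`_l) ->
  i \in top_coins k p -> j \notin top_coins k p -> p`_j + gap k p <= p`_i.
Proof.
move=> /andP[k0 kp] p0 itop jtop.
have le_i : ranked_bias p k <= p`_i.
  case/mapP: itop => m; rewrite mem_iota add1n ltnS => /andP[m0 mk] ->.
  by apply: ranked_bias_anti; rewrite ?m0// ltnW.
have le_j : p`_j <= ranked_bias p k.+1.
  (* A name beyond the stream has default bias 0. *)
  have [jp|pj] := ltnP j (size p); last first.
    by rewrite [p`_j]nth_default//; exact: p0.
  have : j \in ranking p by rewrite mem_sort mem_iota.
  move=> /(nthP 0%N)[m]; rewrite size_ranking => mp mj.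
  rewrite -mj; apply: (@ranked_bias_anti _ k.+1 m.+1) => //=.
  rewrite ltnS leqNgt; apply: contra jtop => mk; apply/mapP; exists m.+1 => //.
  by rewrite mem_iota /= add1n ltnS.
by rewrite /gap; lra.
Qed.

End Ranking.

(** * Error bound for one round of tosses *)

Section Confidence.
Context {R : realType}.

(** After multiplication by [1 + D / 2] the left side is at most [1 + D / 2 - D ^+ 2 / 4]. As
    [1 + D / 2 <= 3 / 2], the constant [1 / 6] suffices. *)
Lemma pair_bias_le (x y D : R) : 0 <= x <= 1 -> 0 <= y <= 1 -> 0 < D <= 1 ->
  y + D <= x ->
  (1 - y + y * (1 + D / 2)) * (1 - x + x * (1 + D / 2)^-1) <= 1 - D ^+ 2 / 6.
Proof.
move=> /andP[x0 x1] /andP[y0 y1] /andP[D0 D1] yDx.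
have th0 : 0 < 1 + D / 2 by lra.
rewrite -(ler_pM2r th0).
have -> : (1 - y + y * (1 + D / 2)) * (1 - x + x * (1 + D / 2)^-1) *
    (1 + D / 2) = (1 + y * (D / 2)) * (1 + (1 - x) * (D / 2)).
  by field; apply: lt0r_neq0; lra.
have xy1 : (1 - x) * y <= 1.
  by rewrite -[leRHS]mulr1 ler_pM//; lra.
have D2 : D ^+ 2 * (1 + D / 2) <= D ^+ 2 * (3 / 2).
  by rewrite ler_wpM2l ?sqr_ge0//; lra.
have xyD : D * (y + D) <= D * x by rewrite ler_wpM2l// ltW.
have : D ^+ 2 * ((1 - x) * y) <= D ^+ 2 * 1 by rewrite ler_wpM2l ?sqr_ge0.
nra.
Qed.

Lemma confidence_le (D mu : R) (N : nat) : 0 < D <= 1 -> 0 < mu ->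
  48 * - ln mu <= D ^+ 2 * N%:R -> (1 - D ^+ 2 / 6) ^+ N <= mu ^+ 8.
Proof.
move=> /andP[D0 D1] mu0 leN.
have D2 : D ^+ 2 <= 1 by rewrite expr_le1// ltW.
apply: (@le_trans _ _ (expR (- (D ^+ 2 / 6)) ^+ N)).
  by rewrite lerXn2r ?nnegrE ?expR_ge0 ?expR_ge1Dx//; lra.
by rewrite -expRM_natr -[mu ^+ 8]lnK ?posrE ?exprn_gt0// ler_expR lnXn//; lra.
Qed.

End Confidence.

(** * Choice of the parameters and conclusion *)

Lemma gap_le1 (R : realType) k (p : seq R) : (forall i, 0 <= p`_i <= 1) ->
  gap k p <= 1.
Proof.
move=> p01; rewrite /gap /ranked_bias.
have /andP[_] := p01 (ranked_coin p k); have /andP[+ _] := p01 (ranked_coin p k.+1).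
lra.
Qed.

(* The factor 48 = 6 * 8 makes a round err with probability at most
   (delta / k) ^+ 8, see [confidence_le]. *)
Definition sample_size (R : realType) (k : nat) (D delta : R) : nat :=
  48 * (Num.trunc (ln (k%:R / delta) / D ^+ 2)).+1.

Theorem theorem2 (R : realType) :
  exists (Ctoss Cmem : nat) (alg : nat -> R -> R -> streaming_algorithm),
  forall (k n : nat) (delta : R) (p : n.-tuple R),
    (1 <= k)%N -> (k < n)%N ->
    0 < delta -> delta < 1 / 2 ->
    (forall i : 'I_n, 0 <= tnth p i <= 1) ->
    0 < gap k p ->
    let D := run (alg k (gap k p) delta) p in
    [/\ 1 - delta <= Pr D (fun x => perm_eq x.1 (top_coins k p)),
        surely D (fun x => (tosses x.2)%:R <=
          Ctoss%:R * (n%:R / gap k p ^+ 2 * ln (k%:R / delta))),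
        surely D (fun x => (peak x.2 <= Cmem * k)%N) &
        surely D (fun x => legal x.2)].
Proof.
(* 1008 = 7 * 48 * 3: [7 * N] tosses per coin, 48 from [sample_size], and 3 for rounding up. *)
exists 1008%N, 2%N, (fun k D delta => kings_algorithm k (sample_size k D delta)).
move=> k n delta p k1 kn delta0 delta1 tp01 gap0.
have p01 i : 0 <= p`_i <= 1.
  have [ni|lt_in] := ltnP i n.
    by rewrite -(tnth_nth 0 p (Ordinal ni)).
  by rewrite nth_default ?size_tuple// lexx ler01.
set Dk := gap k p in gap0 *; set N := sample_size k Dk delta.
have Dk1 : Dk <= 1 by exact: gap_le1.
have k0 : 0 < k%:R :> R by rewrite ltr0n.
have k1R : 1 <= k%:R :> R by rewrite ler1n.
pose mu := delta / k%:R.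
have mu0 : 0 < mu by rewrite divr_gt0.
have kmu : k%:R * mu = delta by rewrite /mu mulrCA divff ?mulr1// gt_eqF.
have mu12 : mu <= 1 / 2.
  by apply: le_trans (ltW delta1); rewrite -kmu ler_peMl// ltW.
have lnE : ln (k%:R / delta) = - ln mu.
  by rewrite -lnV ?posrE// /mu invfM invrK mulrC.
(* This keeps [X] at least [1 / 2], so that [(Num.trunc X).+1 <= 3 * X]. *)
have ln12 : 1 / 2 <= - ln mu.
  have : ln mu <= ln (1 + - (1 / 2)) by rewrite ler_ln ?posrE//; lra.
  by have := @le_ln1Dx R (- (1 / 2)); lra.
have D2gt0 : 0 < Dk ^+ 2 by rewrite exprn_gt0.
have D2le1 : Dk ^+ 2 <= 1 by rewrite expr_le1// ltW.
pose X := ln (k%:R / delta) / Dk ^+ 2.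
have lnX : - ln mu = X * Dk ^+ 2 by rewrite /X lnE divfK ?gt_eqF.
have X12 : 1 / 2 <= X by rewrite ler_pdivlMr// lnE; nra.
have NE : N = (48 * (Num.trunc X).+1)%N by [].
have [truncX Xtrunc] : (Num.trunc X)%:R <= X /\ X <= (Num.trunc X).+1%:R.
  have /andP[-> /ltW ->] // : (Num.trunc X)%:R <= X < (Num.trunc X).+1%:R.
  by apply: truncn_itv; lra.
pose q := (1 - Dk ^+ 2 / 6) ^+ N.
have q0 : 0 <= q by rewrite exprn_ge0//; lra.
have qmu : q <= mu ^+ 8.
  apply: confidence_le; rewrite ?gap0// lnX NE natrM.
  by have := ler_wpM2r (ltW D2gt0) Xtrunc; lra.
have sizeG : size (top_coins k p) = k by exact: size_top_coins.
have kn' : (k <= size p)%N by rewrite size_tuple ltnW.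
have confident i j : i \in top_coins k p -> j \notin top_coins k p ->
    (1 - p`_j + p`_j * (1 + Dk / 2)) ^+ N *
    (1 - p`_i + p`_i * (1 + Dk / 2)^-1) ^+ N <= q.
  move=> itop jtop.
  have le_bias : p`_j + Dk <= p`_i.
    apply: gap_top_coins itop jtop; rewrite ?k1 ?size_tuple// => l.
    by case/andP: (p01 l).
  have /andP[pi0 pi1] := p01 i; have /andP[pj0 pj1] := p01 j.
  have inv0 : 0 < (1 + Dk / 2)^-1 by rewrite invr_gt0; lra.
  rewrite -exprMn lerXn2r ?nnegrE//; last first.
  - by apply: pair_bias_le; rewrite ?gap0.
  - lra.
  by rewrite mulr_ge0// addr_ge0 ?subr_ge0// mulr_ge0//; lra.
(* The exponent 8 is split as 5 + 3: three factors [mu] absorb the [k ^ 3] of the matching errors,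
   and the other five leave at most [mu]. *)
have mu5 : mu ^+ 5 <= mu by rewrite -[leRHS]expr1 ler_wiXn2l// ?ltW//; lra.
have kmu3 : (k%:R * mu) ^+ 3 <= 1 / 8.
  have -> : 1 / 8 = (1 / 2) ^+ 3 :> R by field.
  by rewrite kmu lerXn2r ?nnegrE ?ltW//; lra.
have mu8 : mu ^+ 8 <= mu / 8.
  have -> : mu ^+ 8 = mu ^+ 5 * mu ^+ 3 by rewrite -exprD.
  have mu3 : mu ^+ 3 <= 8^-1.
    have -> : 8^-1 = (1 / 2) ^+ 3 :> R by field.
    by rewrite lerXn2r ?nnegrE ?(ltW mu0)//; lra.
  by apply: ler_pM => //; rewrite exprn_ge0// ltW.
(* With [lam = mu / 4], the term [2 * lam] takes half of [mu] and the matching errors at most a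
   quarter. *)
have [] := @kings_run R p p01 N (mem (top_coins k p)) (1 + Dk / 2) q (mu / 4) mu
  (top_coins k p).
- by lra.
- exact: confident.
- lra.
- lra.
- exact: q0.
- lra.
- exact: top_coins_uniq.
- by [].
- rewrite sizeG.
  have : (k * (2 * k ^ 2))%:R * q <= 2 * (mu * (1 / 8)).
    apply: (@le_trans _ _ (2 * (mu ^+ 5 * (k%:R * mu) ^+ 3))).
      rewrite !natrM.
      have -> : k%:R * (2 * (k%:R * k%:R)) * q = 2 * (k%:R ^+ 3 * q) :> R by ring.
      have -> : mu ^+ 5 * (k%:R * mu) ^+ 3 = k%:R ^+ 3 * mu ^+ 8 by ring.
      by rewrite !ler_wpM2l// exprn_ge0// ltW.
    by rewrite ler_wpM2l//; apply: ler_pM => //; rewrite exprn_ge0 ?kmu// ltW.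
  lra.
- by rewrite sizeG.
- exact: top_coins_lt.
- by rewrite sizeG.
rewrite sizeG kmu => PrD tossD peakD legalD D; split=> //.
apply: surelyW tossD => x tossx.
have : (tosses x.2)%:R <= (7 * N * n)%:R :> R.
  by rewrite ler_nat; move: tossx; rewrite size_tuple.
move=> /le_trans; apply.
have -> : n%:R / Dk ^+ 2 * ln (k%:R / delta) = X * n%:R :> R.
  by rewrite /X; ring.
rewrite natrM mulrA ler_wpM2r// NE !natrM.
have : (Num.trunc X).+1%:R <= 3 * X :> R by rewrite -natr1; lra.
lra.
Qed.
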